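(* Let $\Sigma=\{1,\dots,k\}$ be a finite alphabet and let $\sigma\colon\Sigma^{\mathbb{N}}\to\Sigma^{\mathbb{N}}$ be the left-sided full shift. Then: (i) there exists an almost additive sequence (with respect to $\sigma$) of continuous functions that is generated by a quasi-Bernoulli measure on $\Sigma^{\mathbb{N}}$ and is not physically equivalent to any additive sequence $(S_nf)_{n\in\mathbb{N}}$ generated by a Hölder continuous function $f\colon\Sigma^{\mathbb{N}}\to\mathbb{R}$; (ii) there exist almost additive sequences (with respect to $\sigma$) of Hölder continuous functions with bounded variation which are not physically equivalent to any additive sequence $(S_nf)_{n\in\mathbb{N}}$ generated by a Hölder continuous function $f\colon\Sigma^{\mathbb{N}}\to\mathbb{R}$.
   Context: $\mathbb{N}=\{1,2,\dots\}$. $\Sigma^{\mathbb{N}}$ is the space of sequences $x=(i_1i_2\cdots)$ with $i_n\in\Sigma$, with the usual metric (e.g. $d(x,y)=2^{-\min\{n: x_n\ne y_n\}}$ for $x\neq y$), and $\sigma(i_1i_2i_3\cdots)=(i_2i_3\cdots)$. Hölder continuity is with respect to $d$. The cylinder is $C_{i_1\ldots i_n}=\{(j_1j_2\cdots)\in\Sigma^{\mathbb{N}}: j_1=i_1,\dots,j_n=i_n\}$, and for $x=(i_1i_2\cdots)$, $C_{i_1\ldots i_n}(x)$ is the $n$-cylinder containing $x$. $S_nf=\sum_{j=0}^{n-1}f\circ\sigma^j$, and $\|\cdot\|_\infty$ is the supremum norm. Almost additive: $(f_n)_{n\in\mathbb N}$ is almost additive if there is $C>0$ with $-C+f_m(x)+f_n(\sigma^m(x))\le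 f_{m+n}(x)\le f_m(x)+f_n(\sigma^m(x))+C$ for all $x$ and all $m,n\ge1$. Bounded variation: there is $\varepsilon>0$ with $\sup_{n}\sup\{|f_n(x)-f_n(y)|: d(\sigma^j(x),\sigma^j(y))<\varepsilon \text{ for } 0\le j\le n-1\}<\infty$. Physically equivalent: $(f_n)_{n\in\mathbb N}$ and $(g_n)_{n\in\mathbb N}$ are physically equivalent if $\lim_{n\to\infty}\frac1n\|f_n-g_n\|_\infty=0$. Quasi-Bernoulli: a probability measure $\mu$ on $\Sigma^{\mathbb{N}}$ is quasi-Bernoulli if $\mu(C_j)>0$ for every $j\in\Sigma$ and there is $C\ge1$ with $C^{-1}\le \frac{\mu(C_{j_1\cdots j_{n+m}})}{\mu(C_{j_1\cdots j_n})\mu(C_{j_{n+1}\cdots j_{n+m}})}\le C$ for all $m,n\ge1$ and all $j_1,\dots,j_{n+m}\in\Sigma$. The sequence generated by a quasi-Bernoulli measure $\nu$ is $f_n(x)=\log\nu(C_{i_1\ldots i_n}(x))$.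
   Formalization: The alphabet is assumed to have at least two letters (k ≥ 2); for k = 1 the shift space is a single point, every almost additive sequence is physically equivalent to (S_n c) for a constant c, and the claim fails. *)

(* Defs.v *)
From HB Require Import structures.
From mathcomp Require Import all_boot all_order all_algebra.
From mathcomp Require Import all_classical all_reals all_analysis.

Set Implicit Arguments.
Unset Strict Implicit.
Unset Printing Implicit Defensive.

Import Order.TTheory GRing.Theory Num.Theory.
Import numFieldNormedType.Exports.

Local Open Scope classical_set_scope.
Local Open Scope ring_scope.

(* For k >= 1, 'I_k.-1.+1 is 'I_k: the alphabet has exactly k letters. The
   successor form is needed because measurable types are pointed. *)
Definition letter (k : nat) := 'I_k.-1.+1.

(* The letter i_n of x = (i_1 i_2 ...) is x n.-1: coordinates start at 0.
   R is a phantom parameter: the field in which the metric takes values. *)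
Definition fullshift (R : realType) (k : nat) := nat -> letter k.

Section shift_metric.
Variables (R : realType) (k : nat).
Implicit Types x y z : fullshift R k.

(* 2 ^ (- min {n >= 1 | i_n <> j_n}); the .+1 translates 0-based positions. *)
Definition shift_dist x y : R :=
  if pselect (exists n, x n != y n) is left neq_xy
  then 2 ^- (ex_minn neq_xy).+1 else 0.

Let shift_distxx x : shift_dist x x = 0.
Proof.
rewrite /shift_dist; case: pselect => // h; exfalso.
by case: h => n; rewrite eqxx.
Qed.

Let shift_dist_eq0 x y : shift_dist x y = 0 -> x = y.
Proof.
rewrite /shift_dist; case: pselect => [h /eqP|h _].
  by rewrite invr_eq0 expf_eq0/= pnatr_eq0.
by apply/funext => n; apply/eqP/negPn/negP => xyn; apply: h; exists n.
Qed.

Let shift_dist_sym x y : shift_dist x y = shift_dist y x.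
Proof.
rewrite /shift_dist; case: pselect => h; case: pselect => h' //.
- by congr (2 ^- _.+1); apply: eq_ex_minn => n; rewrite eq_sym.
- by exfalso; apply: h'; case: h => n; exists n; rewrite eq_sym.
- by exfalso; apply: h; case: h' => n; exists n; rewrite eq_sym.
Qed.

Let shift_dist_ge0 x y : 0 <= shift_dist x y.
Proof.
by rewrite /shift_dist; case: pselect => // h; rewrite invr_ge0 exprn_ge0.
Qed.

Let shift_dist_triangle y x z :
  shift_dist x z <= shift_dist x y + shift_dist y z.
Proof.
rewrite {1}/shift_dist; case: pselect => [h|_]; last by rewrite addr_ge0.
case: ex_minnP => m xzm xz.
have le_dist u v : u m != v m -> 2 ^- m.+1 <= shift_dist u v.
  move=> uvm; rewrite /shift_dist; case: pselect => [h'|]; last first.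
    by case; exists m.
  case: ex_minnP => p _ /(_ _ uvm) pm.
  by rewrite lef_pV2 ?posrE ?exprn_gt0// ler_eXn2l ?ltr1n.
have [xym|xym] := eqVneq (x m) (y m).
  by rewrite -[leLHS]add0r lerD// le_dist// -xym.
by rewrite -[leLHS]addr0 lerD// le_dist.
Qed.

HB.instance Definition _ := Choice.on (fullshift R k).
HB.instance Definition _ := isPointed.Build (fullshift R k) (fun=> ord0).
HB.instance Definition _ := isMetric.Build R (fullshift R k)
  shift_distxx shift_dist_eq0 shift_dist_sym shift_dist_triangle.

End shift_metric.

Section definitions.
Variables (R : realType) (k : nat).
Local Notation X := (fullshift R k).
Implicit Types (x y : X) (phi : X -> R) (f g : nat -> X -> R).

Definition left_shift x : X := fun n => x n.+1.

Definition birkhoff_sum phi (n : nat) x : R :=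
  \sum_(j < n) phi (iter j left_shift x).

Definition hoelder_continuous phi :=
  exists C alpha : R,
    0 < alpha /\ forall x y, `|phi x - phi y| <= C * mdist x y `^ alpha.

(* Sequences (f_n), n >= 1, are given as maps on nat whose value at 0 is
   irrelevant. *)
Definition almost_additive f :=
  exists2 C : R, 0 < C & forall x m n, (1 <= m)%N -> (1 <= n)%N ->
    - C + f m x + f n (iter m left_shift x) <= f (m + n)%N x
      <= f m x + f n (iter m left_shift x) + C.

Definition bounded_variation_seq f :=
  exists2 eps : R, 0 < eps &
    (ereal_sup [set ereal_sup [set `|f n xy.1 - f n xy.2|%:E | xy in
        [set xy : X * X | forall j, (j < n)%N ->
          (mdist (iter j left_shift xy.1) (iter j left_shift xy.2) < eps)%R]]
      | n in [set n | (1 <= n)%N]] < +oo)%E.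

(* Extended-real valued: the real-valued sup of an unbounded set is 0. *)
Definition sup_norm phi : \bar R := ereal_sup [set `|phi x|%:E | x in setT].

Definition physically_equivalent f g :=
  ((n%:R^-1)%:E * sup_norm (fun x => f n x - g n x)%R)%E @[n --> \oo] --> 0%E.

Definition cylinder (w : seq (letter k)) : set X :=
  [set x | mkseq x (size w) = w].

Definition borel_shift := g_sigma_algebraType (@open X).

Definition quasi_bernoulli (mu : probability borel_shift R) :=
  (forall j : letter k, (0 < mu (cylinder [:: j]))%E) /\
  exists2 C : R, 1 <= C & forall u v : seq (letter k),
    (1 <= size u)%N -> (1 <= size v)%N ->
    C^-1 <= fine (mu (cylinder (u ++ v))) /
            (fine (mu (cylinder u)) * fine (mu (cylinder v))) <= C.

Definition generated_by (nu : probability borel_shift R) f :=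
  forall n x, (1 <= n)%N -> f n x = ln (fine (nu (cylinder (mkseq x n)))).

End definitions.

(* Main.v *)
Require Import Defs.
From HB Require Import structures.
From mathcomp Require Import all_boot all_order all_algebra.
From mathcomp Require Import all_classical all_reals all_analysis.
From mathcomp Require Import ring lra zify.

(* A hidden Markov measure witnesses both parts. The hidden state is the parity
   of the current run of a distinguished letter 0, which flips the state; every
   other letter resets it to even. The masses of a word started from the two
   states are comparable, so the measure is quasi-Bernoulli. Let a be a letter
   other than 0 and F(n) the log mass of the word 0^n a. On the periodic point
   x_n = (0^n a)^oo the log masses are exactly additive along the period, so
   physical equivalence to S_n phi forces F(n) = S_(n+1) phi (x_n). If phi is
   Hoelder, then F(n+1) - F(n) - phi(x_(n+1)) tends to 0, and so does the second
   difference of F; but that second difference is ln 8 at every even n. *)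

Set Implicit Arguments.
Unset Strict Implicit.
Unset Printing Implicit Defensive.

Import Order.TTheory GRing.Theory Num.Theory.
Import numFieldNormedType.Exports.

Local Open Scope classical_set_scope.
Local Open Scope ring_scope.

(** * Prefixes, cylinders and Hölder functions for the shift metric *)

Section shift_metric_theory.
Variables (R : realType) (k : nat).
Implicit Types x y : fullshift R k.

Lemma mdist_le_prefix n x y : mkseq x n = mkseq y n -> mdist x y <= 2 ^- n.+1.
Proof.
move=> xyn; rewrite [mdist x y]/(shift_dist x y) /shift_dist.
case: pselect => [h|_]; last by rewrite invr_ge0 exprn_ge0.
case: ex_minnP => m xym _.
rewrite lef_pV2 ?posrE ?exprn_gt0// ler_eXn2l ?ltr1n// ltnS leqNgt.
apply/negP => mn; case/negP: xym.
by rewrite -(nth_mkseq ord0 x mn) xyn nth_mkseq.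
Qed.

Lemma prefix_mdist_lt n x y : mdist x y < 2 ^- n -> mkseq x n = mkseq y n.
Proof.
rewrite [mdist x y]/(shift_dist x y) /shift_dist.
case: pselect => [h|h _]; last first.
  apply/eq_mkseq => i; apply/eqP/negPn/negP => xyi.
  by apply: h; exists i.
case: ex_minnP => m _ m_min.
rewrite ltf_pV2 ?posrE ?exprn_gt0// ltr_eXn2l ?ltr1n// ltnS => nm.
apply: (@eq_from_nth _ ord0) => [|i]; rewrite !size_mkseq// => i_n.
rewrite !nth_mkseq//; apply/eqP/negPn/negP => /m_min.
by rewrite leqNgt (leq_trans i_n nm).
Qed.

(** There are only countably many words, so this reduces Borel measurability to preimages of
    cylinders. *)
Lemma open_bigcup_cylinder (U : set (fullshift R k)) : open U ->
  U = \bigcup_(w in [set w | @cylinder R k w `<=` U]) cylinder w.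
Proof.
move=> oU; apply/seteqP; split => [x Ux|x [w wU wx]]; last exact: wU.
have := open_nbhs_nbhs (conj oU Ux); rewrite -nbhs_ballE => -[e /= e0 xeU].
have [n ne] : exists n, 2 ^- n.+1 < e.
  have [n _ /(_ _ (leqnn n)) ne] := near_infty_natSinv_expn_lt (PosNum e0).
  exists n; rewrite (le_lt_trans _ ne)// div1r.
  by rewrite lef_pV2 ?posrE ?exprn_gt0// ler_eXn2l ?ltr1n.
exists (mkseq x n) => /=; last by rewrite /cylinder/= size_mkseq.
rewrite /cylinder => y /=; rewrite size_mkseq => yx; apply: xeU.
by rewrite ballEmdist/= (le_lt_trans _ ne)// mdist_le_prefix.
Qed.

Lemma continuous_hoelder (phi : fullshift R k -> R) :
  hoelder_continuous phi -> continuous phi.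
Proof.
move=> [C [a [a0 Ca]]] x; apply/(@cvgrPdist_lt _ _ _ _ (nbhs_filter x)) => e e0.
(* The Hölder constant [C] may be zero or negative; [|C| + 1] is a positive bound for it by which
   one can divide. *)
have C1 : 0 < `|C| + 1 by rewrite ltr_wpDl.
have d0 : 0 < (e / (`|C| + 1)) `^ a^-1 by rewrite powR_gt0// divr_gt0.
rewrite -nbhs_ballE; exists ((e / (`|C| + 1)) `^ a^-1) => //= y.
rewrite ballEmdist/= => xy; rewrite (le_lt_trans (Ca x y))//.
have xye : mdist x y `^ a < e / (`|C| + 1).
  have -> : e / (`|C| + 1) = ((e / (`|C| + 1)) `^ a^-1) `^ a.
    by rewrite -powRrM mulVf ?gt_eqF// powRr1// ltW// divr_gt0.
  by rewrite gt0_ltr_powR// nnegrE ?mdist_ge0// ltW.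
rewrite (@le_lt_trans _ _ ((`|C| + 1) * mdist x y `^ a))//.
  by rewrite ler_wpM2r ?powR_ge0// ler_wpDr// ler_norm.
by rewrite mulrC -ltr_pdivlMr.
Qed.

(** Points closer than 2^-n share their first [n] letters, hence the value. For all others the
    difference is at most twice the bound [B] over the finitely many prefixes, so the function is
    Lipschitz with constant 2^n * 2B. *)
Lemma hoelder_prefix n (h : seq (letter k) -> R) :
  hoelder_continuous (fun x : fullshift R k => h (mkseq x n)).
Proof.
pose B := \sum_(w : n.-tuple (letter k)) `|h w|.
have hB (x : fullshift R k) : `|h (mkseq x n)| <= B.
  have sx : size (mkseq x n) == n by rewrite size_mkseq.
  by rewrite /B (bigD1 (Tuple sx))//= lerDl sumr_ge0.
exists (2 ^+ n * (B + B)), 1; split=> // x y; rewrite powRr1 ?mdist_ge0//.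
have [/prefix_mdist_lt ->|nxy] := ltP (mdist x y) (2 ^- n).
  by rewrite subrr normr0 !mulr_ge0 ?mdist_ge0// addr_ge0// sumr_ge0.
rewrite (le_trans (ler_normB _ _))//.
rewrite (le_trans (lerD (hB x) (hB y)))// mulrAC ler_peMl//.
  by rewrite addr_ge0// sumr_ge0.
by rewrite -ler_pdivrMl ?exprn_gt0// mulr1.
Qed.

Lemma iter_left_shift n x i : iter n (@left_shift R k) x i = x (n + i)%N.
Proof. by elim: n i => //= n IH i; rewrite /left_shift IH addnS. Qed.

(** Two points at distance less than 1/2 have the same first letter. Orbits that stay this close for
    [n] steps share the whole prefix, so the variation is 0. *)
Lemma bounded_variation_prefix (h : seq (letter k) -> R) :
  bounded_variation_seq (fun n (x : fullshift R k) => h (mkseq x n)).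
Proof.
exists 2^-1; first by rewrite invr_gt0.
apply: (@le_lt_trans _ _ 0%E) => //.
apply: ub_ereal_sup => _ [n n1 <-]; apply: ub_ereal_sup => _ [[x y] /= xy <-].
suff -> : mkseq x n = mkseq y n by rewrite subrr normr0.
apply: (@eq_from_nth _ ord0) => [|i]; rewrite !size_mkseq// => i_n.
rewrite !nth_mkseq//.
have /(prefix_mdist_lt (n := 1))[] : mdist (iter i (@left_shift R k) x)
    (iter i (@left_shift R k) y) < 2 ^- 1 by rewrite expr1; apply: xy.
by rewrite !iter_left_shift addn0.
Qed.

End shift_metric_theory.

(** * Construction of a probability measure with prescribed cylinder masses *)

Section cylinder_masses.
Variables (R : realType) (k : nat) (m : seq (letter k) -> R).
Hypotheses (m_ge0 : forall w, 0 <= m w) (m_nil : m [::] = 1)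
  (m_rcons : forall w, m w = \sum_j m (rcons w j)).
Implicit Types (t : R) (w : seq (letter k)).

Let before w n : R := \sum_(j : letter k | (j < n)%N) m (rcons w j).

Let beforeS w (j : letter k) : before w j.+1 = before w j + m (rcons w j).
Proof.
rewrite /before (bigD1 j) /=; last exact: leqnn.
rewrite addrC; congr (_ + _); apply: eq_bigl => i /=.
by rewrite ltnS andbC [RHS]ltn_neqAle.
Qed.

Let le_before w n p : (n <= p)%N -> before w n <= before w p.
Proof.
move=> np; rewrite /before.
rewrite (bigID (fun j : letter k => (j < n)%N) (fun j => (j < p)%N))/=.
rewrite [X in _ <= X + _](eq_bigl (fun j : letter k => (j < n)%N)) => [|j].
  by rewrite lerDl sumr_ge0.
by rewrite andbC; case: ltnP => // /leq_trans ->.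
Qed.

(* Nested intervals: that of w has length m w and is cut, in the order of the
   letters, into the intervals of the words rcons w j. *)
Let left_end w : R := \sum_(i < size w) before (take i w) (nth ord0 w i).

Let left_end_rcons w j : left_end (rcons w j) = left_end w + before w j.
Proof.
rewrite /left_end size_rcons big_ord_recr/=; congr (_ + _).
  apply: eq_bigr => i _; rewrite nth_rcons ltn_ord -cats1.
  by rewrite takel_cat// ltnW.
by rewrite nth_rcons ltnn eqxx -cats1 take_size_cat.
Qed.

Let subdivision w t := left_end w <= t < left_end w + m w.

Let subdivision_rcons w j t :
  subdivision (rcons w j) t = (before w j <= t - left_end w < before w j.+1).
Proof.
rewrite /subdivision left_end_rcons beforeS -addrA.
by rewrite lerBrDl ltrBlDl.
Qed.

Let subdivision_rconsW w j t : subdivision (rcons w j) t -> subdivision w t.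
Proof.
rewrite subdivision_rcons => /andP[tj jt]; apply/andP; split.
  by rewrite -subr_ge0 (le_trans _ tj)// sumr_ge0.
rewrite -ltrBlDl (lt_le_trans jt)// m_rcons.
rewrite (le_trans (le_before _ (ltn_ord j)))//.
by rewrite /before (eq_bigl predT)// => i /=; rewrite ltn_ord.
Qed.

Let subdivision_ex w t : subdivision w t -> exists j, subdivision (rcons w j) t.
Proof.
move=> /andP[wt tw].
(* The least [n] whose cumulative mass exceeds the offset of [t] is positive; its predecessor is the
   required letter. *)
have ex : exists n, t - left_end w < before w n.
  exists k.-1.+1; rewrite /before (eq_bigl predT) => [|i /=]; last first.
    by rewrite ltn_ord.
  by rewrite -m_rcons ltrBlDl.
case: (ex_minnP ex) => -[|n] nt n_min.
  by move: nt; rewrite /before big_pred0// ltNge subr_ge0 wt.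
have nk : (n < k.-1.+1)%N.
  apply: n_min; rewrite /before (eq_bigl predT) => [|i /=]; last first.
    by rewrite ltn_ord.
  by rewrite -m_rcons ltrBlDl.
exists (Ordinal nk); rewrite subdivision_rcons nt andbT leNgt.
by apply/negP => /n_min; rewrite ltnn.
Qed.

Let subdivision_uniq w i j t :
  subdivision (rcons w i) t -> subdivision (rcons w j) t -> i = j.
Proof.
wlog ij : i j / (i <= j)%N.
  by move=> H; case: (leqP i j) => [/H//|/ltnW /H + ti tj] => /(_ tj ti).
rewrite !subdivision_rcons => /andP[_ ti] /andP[jt _].
apply/val_inj/eqP; rewrite eqn_leq ij/= leqNgt.
apply/negP => /(le_before w); rewrite leNgt => /negP; apply.
exact: le_lt_trans ti.
Qed.

(** Meaningful only for [t] in the interval of [w]; [ord0] is a default. *)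
Let digit w t : letter k :=
  odflt ord0 [pick j : letter k | subdivision (rcons w j) t].

Let digits t := fix digits n :=
  if n is n'.+1 then rcons (digits n') (digit (digits n') t) else [::].

(** The point whose prefixes are the words with intervals containing [t]. The constant value outside
    [0, 1[ only makes the map total: that set has measure 0 for [unit_lebesgue]. *)
Let code t : fullshift R k :=
  fun n => if t \in `[0, 1[ then digit (digits t n) t else ord0.

Let digitP w j t : subdivision w t ->
  subdivision (rcons w j) t = (j == digit w t).
Proof.
move=> /subdivision_ex[i it]; rewrite /digit; case: pickP => [l lt|/(_ i)];
  last by rewrite it.
by apply/idP/eqP => [/subdivision_uniq|->//]; apply.
Qed.

Let digitsP w t : t \in `[0, 1[ -> subdivision w t = (digits t (size w) == w).
Proof.
move=> t01; elim/last_ind: w => [|w j IH].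
  rewrite eqxx /subdivision /left_end big_ord0 m_nil add0r.
  by move: t01; rewrite in_itv.
rewrite size_rcons /= eqseq_rcons.
apply/idP/andP => [jt|[/eqP wE /eqP<-]]; last by rewrite wE digitP// IH wE.
have wt := subdivision_rconsW jt.
have /eqP wE : digits t (size w) == w by rewrite -IH.
by rewrite wE eqxx eq_sym -digitP.
Qed.

Let preimage_code_cylinder w :
  code @^-1` cylinder w `&` `[0, 1[ = `[left_end w, left_end w + m w[%classic.
Proof.
have codeE t n : t \in `[0, 1[ -> mkseq (code t) n = digits t n.
  move=> t01; elim: n => //= n IH.
  by rewrite mkseqS IH /code t01.
apply/seteqP; split => t; rewrite /= /cylinder /=.
  by move=> [+ t01]; rewrite codeE// => /eqP; rewrite -digitsP.
rewrite in_itv/= => wt; have t01 : t \in `[0, 1[.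
  rewrite in_itv/=; have : subdivision w t by [].
  elim/last_ind: w {wt} => [|w j IH /subdivision_rconsW//].
  by rewrite /subdivision /left_end big_ord0 add0r m_nil.
by split=> //; rewrite codeE//; apply/eqP; rewrite -digitsP.
Qed.

Let measurable_code :
  measurable_fun setT (code : measurableTypeR R -> borel_shift R k).
Proof.
apply: (@measurability _ _ (measurableTypeR R) (borel_shift R k) setT code
  (@open (fullshift R k))) => //.
move=> _ [U oU <-]; rewrite setTI (open_bigcup_cylinder oU) preimage_bigcup.
rewrite bigcup_mkcond.
apply: countable_bigcupT_measurable => [|w]; first exact: countableP.
case: ifP => // _.
(* Inside [0, 1[ the preimage is an interval; outside, where [code] is constant, it is everything or
   nothing. *)
rewrite -[X in measurable X](setUIDK _ (`[0, 1[%classic)).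
apply: measurableU.
  by rewrite preimage_code_cylinder; exact: measurable_itv.
rewrite (_ : _ `\` _ = (if mkseq (fun=> ord0) (size w) == w
    then setT else set0) `\` `[0, 1[%classic).
  by apply: measurableD; [case: ifP|exact: measurable_itv].
have out t : ~ (t \in `[0, 1[) -> code t = fun=> ord0.
  by move=> /negP/negbTE t01; apply/funext => n; rewrite /code t01.
apply/seteqP; split => t /= [wt t01]; split => //.
  by move: wt; rewrite /cylinder/= out// => ->; rewrite eqxx.
by move: wt; rewrite /cylinder/= out//; case: eqP.
Qed.

Let unit_lebesgue := mrestr (@lebesgue_measure R)
  (measurable_itv `[0 : R, 1[ : measurable (`[0, 1[%classic : set R)).

Let unit_lebesgueT : unit_lebesgue setT = 1%E.
Proof.
by rewrite /unit_lebesgue /mrestr setTI lebesgue_measure_itv/= lte_fin ltr01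
  oppr0 adde0.
Qed.

HB.instance Definition _ := Measure.on unit_lebesgue.
HB.instance Definition _ :=
  Measure_isProbability.Build _ _ _ unit_lebesgue unit_lebesgueT.

(** The measure is the image of Lebesgue measure on [0, 1[ under [code]: the cylinder of [w] pulls
    back to an interval of length [m w]. *)
Lemma cylinder_masses_probability :
  exists nu : probability (borel_shift R k) R,
    forall w, nu (cylinder w) = (m w)%:E.
Proof.
exists (distribution unit_lebesgue (mfun_Sub (mem_set measurable_code))) => w.
transitivity (@lebesgue_measure R (code @^-1` cylinder w `&` `[0, 1[)) => //.
rewrite preimage_code_cylinder.
rewrite lebesgue_measure_itv/= lte_fin ltrDl -EFinB addrAC subrr add0r.
(* A word of mass 0 has an empty interval. *)
by case: ltP => // w0; congr EFin; apply/le_anti; rewrite m_ge0 w0.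
Qed.

End cylinder_masses.

(** * Birkhoff sums at periodic points and decay of Hölder variations *)

Section birkhoff.
Variables (R : realType) (k : nat).
Implicit Types (x y : fullshift R k) (phi : fullshift R k -> R).

Lemma mkseq_iter_left_shift x m n :
  mkseq x (m + n) = mkseq x m ++ mkseq (iter m (@left_shift R k) x) n.
Proof.
rewrite /mkseq iotaD map_cat add0n -[in iota m n](addn0 m) iotaDl -map_comp.
by congr (_ ++ _); apply: eq_map => i /=; rewrite iter_left_shift.
Qed.

Lemma birkhoff_sumD phi x m n : birkhoff_sum phi (m + n) x =
  birkhoff_sum phi m x + birkhoff_sum phi n (iter m (@left_shift R k) x).
Proof.
rewrite /birkhoff_sum big_split_ord/=; congr (_ + _).
by apply: eq_bigr => i _; rewrite addnC iterD.
Qed.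

Lemma birkhoff_sum_periodic phi x p m : iter p (@left_shift R k) x = x ->
  birkhoff_sum phi (m * p) x = m%:R * birkhoff_sum phi p x.
Proof.
move=> xp; elim: m => [|m IH].
  by rewrite mul0n mul0r /birkhoff_sum big_ord0.
by rewrite mulSn birkhoff_sumD xp IH -natr1 mulrDl mul1r addrC.
Qed.

(** Along multiples of the period both sequences grow linearly at [x]. A discrepancy at time [p]
    would keep the normalized sup norm at least [c] at all these times. *)
Lemma physically_equivalent_periodic f phi x p : (1 <= p)%N ->
  iter p (@left_shift R k) x = x ->
  (forall m, f (m * p)%N x = m%:R * f p x) ->
  physically_equivalent f (birkhoff_sum phi) -> f p x = birkhoff_sum phi p x.
Proof.
move=> p1 xp fm fphi; apply/eqP; rewrite -subr_eq0; apply/negPn/negP => neq.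
have p0 : 0 < p%:R :> R by rewrite ltr0n.
set c := `|f p x - birkhoff_sum phi p x| / p%:R.
have c0 : 0 < c by rewrite divr_gt0// normr_gt0.
have : nbhs 0%E [set z : \bar R | (z < c%:E)%E].
  by apply: open_nbhs_nbhs; split; [exact: open_ereal_lt_ereal|rewrite /= lte_fin].
(* The time (N+1)p is a multiple of the period beyond the threshold [N]. *)
move=> /fphi[N _ /(_ (N.+1 * p)%N)] /=.
have -> : (N <= N.+1 * p)%N.
  by rewrite (leq_trans (leqnSn N))// leq_pmulr.
move=> /(_ isT); apply/negP; rewrite -leNgt.
have n0 : 0 < ((N.+1 * p)%:R : R) by rewrite ltr0n muln_gt0.
apply: (@le_trans _ _ (((N.+1 * p)%:R^-1)%:E *
    `|f (N.+1 * p)%N x - birkhoff_sum phi (N.+1 * p) x|%:E)%E).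
  rewrite fm birkhoff_sum_periodic// -mulrBr normrM normr_nat -EFinM lee_fin.
  by rewrite natrM invfM mulrACA mulVf ?mul1r ?pnatr_eq0// mulrC.
rewrite lee_pmul2l// ?lte_fin ?invr_gt0//.
by apply: ereal_sup_ubound => /=; exists x.
Qed.

(** For exponent [a] the rate is theta = 2^-a, since a common prefix of length [n] forces distance
    at most 2^-n. *)
Lemma hoelder_prefix_decay phi : hoelder_continuous phi ->
  exists D theta : R, [/\ 0 <= D, 0 < theta, theta < 1 &
    forall n x y, mkseq x n = mkseq y n -> `|phi x - phi y| <= D * theta ^+ n].
Proof.
move=> [C [a [a0 Ca]]]; exists `|C|, (2^-1 `^ a); split => //.
- suff : 2^-1 `^ a < 1 `^ a by rewrite powR1.
  by rewrite gt0_ltr_powR ?nnegrE ?invr_ge0 ?invf_lt1 ?ltr1n.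
- move=> n x y xyn; rewrite (le_trans (Ca x y))//.
rewrite (@le_trans _ _ (`|C| * mdist x y `^ a))//.
  by rewrite ler_wpM2r ?powR_ge0// ler_norm.
rewrite ler_wpM2l// -powR_mulrn ?powR_ge0// -powRrM mulrC powRrM powR_mulrn//.
rewrite ge0_ler_powR ?nnegrE ?mdist_ge0 ?exprn_ge0 ?(ltW a0)//.
rewrite (le_trans (mdist_le_prefix xyn))// exprVn lef_pV2 ?posrE ?exprn_gt0//.
by rewrite ler_eXn2l ?ltr1n.
Qed.

End birkhoff.

(** Each of the n+1 terms of the geometric sum up to q^n is at least q^n. This absorbs the linear
    number of error terms in a Birkhoff sum. *)
Lemma geometric_linear_bound (R : realType) (q : R) n : 0 <= q < 1 ->
  n.+1%:R * q ^+ n <= (1 - q)^-1.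
Proof.
move=> /andP[q0 q1]; rewrite -[leRHS]mul1r ler_pdivlMr ?subr_gt0//.
apply: (@le_trans _ _ ((\sum_(i < n.+1) q ^+ i) * (1 - q))).
  rewrite ler_wpM2r ?subr_ge0 ?(ltW q1)//.
  rewrite mulr_natl -[X in _ *+ X]card_ord -sumr_const.
  by apply: ler_sum => i _; rewrite ler_wiXn2l ?(ltW q1)// -ltnS.
by rewrite mulrC -opprB mulNr -subrX1 opprB gerBl exprn_ge0.
Qed.

(** * The hidden Markov masses and their quasi-Bernoulli property *)

Section hidden_markov.
Variables (R : realType) (k : nat).
Hypothesis hk : (2 <= k)%N.
Implicit Types (b : bool) (u v w : seq (letter k)).

(* The hidden state is the parity of the current run of letters ord0. *)
Definition step b (j : letter k) : bool := (j == ord0) && ~~ b.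

(** Emission probabilities: the odd state [true] doubles the weight of [ord0], and the other k-1
    letters share the rest equally. *)
Definition weight b (j : letter k) : R :=
  if j == ord0 then (if b then 2 else 1) / 3
  else (if b then 1 else 2) / 3 / k.-1%:R.

Fixpoint mass b w : R :=
  if w is j :: w' then weight b j * mass (step b j) w' else 1.

Let k1_gt0 : 0 < k.-1%:R :> R.
Proof. by rewrite ltr0n; case: k hk => [|[]]. Qed.

Lemma weight_gt0 b j : 0 < weight b j.
Proof. by rewrite /weight; case: ifP => _; case: b; rewrite !divr_gt0. Qed.

Lemma mass_gt0 b w : 0 < mass b w.
Proof. by elim: w b => //= j w IH b; rewrite mulr_gt0// weight_gt0. Qed.

Lemma weight_sum b : \sum_j weight b j = 1.
Proof.
rewrite /letter big_ord_recl (eq_bigr (fun=> (if b then 1 else 2) / 3 / k.-1%:R))//.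
rewrite sumr_const card_ord -[_ *+ k.-1]mulr_natr divfK ?gt_eqF// /weight eqxx.
by case: b; field.
Qed.

Lemma mass_cat b u v : mass b (u ++ v) = mass b u * mass (foldl step b u) v.
Proof. by elim: u b => /= [|j u IH] b; rewrite ?mul1r// IH mulrA. Qed.

Lemma mass_rcons b w : mass b w = \sum_j mass b (rcons w j).
Proof.
under eq_bigr do rewrite -cats1 mass_cat /= mulr1.
by rewrite -mulr_sumr weight_sum mulr1.
Qed.

(* On a run of ord0 the two hidden states alternate, so the ratio
   mass false w / mass true w never leaves [1/4, 2]; the first other letter
   merges the two trajectories. *)
Lemma mass_state w : mass false w <= 2 * mass true w /\
  mass true w <= 4 * mass false w.
Proof.
elim: w => [|j w [ft tf]] /=; first by split; lra.
rewrite /weight /step; case: eqP => _ /=; first by split; lra.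
have := mass_gt0 false w; move: (mass false w) => M M0.
have c0 : 0 < k.-1%:R^-1 * M by rewrite mulr_gt0// invr_gt0.
by split; rewrite -!mulrA; lra.
Qed.

(** The prefix [u] influences [v] only through the hidden state it leaves, and by [mass_state]
    changing that state alters the mass of [v] by a factor of at most 4. *)
Lemma mass_cat_bounds u v :
  4^-1 <= mass false (u ++ v) / (mass false u * mass false v) <= 4.
Proof.
have u0 := mass_gt0 false u; have v0 := mass_gt0 false v.
have [ft tf] := mass_state v.
rewrite mass_cat invfM mulrACA divff ?gt_eqF// mul1r.
rewrite ler_pdivlMr// ler_pdivrMr//.
by case: foldl; apply/andP; split; lra.
Qed.

Definition log_mass n (x : fullshift R k) := ln (mass false (mkseq x n)).

Lemma log_mass_almost_additive : almost_additive log_mass.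
Proof.
exists (ln 4) => [|x m n _ _]; first by rewrite ln_gt0// ltr1n.
rewrite /log_mass mkseq_iter_left_shift.
move: (mkseq x m) (mkseq _ n) => u v.
have u0 := mass_gt0 false u; have v0 := mass_gt0 false v.
have uv0 := mass_gt0 false (u ++ v).
have := mass_cat_bounds u v; set q := _ / _ => q4.
have q0 : 0 < q by rewrite divr_gt0// mulr_gt0.
have -> : mass false (u ++ v) = q * (mass false u * mass false v).
  by rewrite /q divfK// mulf_neq0// gt_eqF.
have lnq : - ln 4 <= ln q <= ln 4.
  by rewrite -lnV ?posrE// !ler_ln ?posrE ?invr_gt0// q4.
clearbody q; rewrite !lnM ?posrE ?mulr_gt0//.
by case/andP: lnq => *; apply/andP; split; lra.
Qed.

Lemma log_mass_quasi_bernoulli : exists2 nu : probability (borel_shift R k) R,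
  quasi_bernoulli nu & generated_by nu log_mass.
Proof.
have mass_ge0 w : 0 <= mass false w by rewrite ltW ?mass_gt0.
have [nu nuE] := cylinder_masses_probability mass_ge0 erefl (mass_rcons false).
exists nu; last by move=> n x _; rewrite nuE.
split => [j|]; first by rewrite nuE lte_fin mass_gt0.
by exists 4 => [|u v _ _]; [rewrite ler1n|rewrite !nuE mass_cat_bounds].
Qed.

(** * Log masses at periodic points and the obstruction to Hölder potentials *)

Lemma log_mass_periodic x p m : iter p (@left_shift R k) x = x ->
  foldl step false (mkseq x p) = false ->
  log_mass (m * p) x = m%:R * log_mass p x.
Proof.
move=> xp sp; elim: m => [|m IH].
  by rewrite mul0n mul0r /log_mass ln1.
rewrite mulSn /log_mass mkseq_iter_left_shift xp mass_cat sp.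
by rewrite lnM ?posrE ?mass_gt0// -!/(log_mass _ _) IH -natr1 mulrDl mul1r addrC.
Qed.

(* x_n = (0 ... 0 a)^oo, with n letters 0 and a the last letter *)
Let spike n : fullshift R k :=
  fun i => if (i %% n.+1 == n)%N then ord_max else ord0.

Let spike_periodic n : iter n.+1 (@left_shift R k) (spike n) = spike n.
Proof. by apply/funext => i; rewrite iter_left_shift /spike modnDl. Qed.

Let mkseq_spike n : mkseq (spike n) n = nseq n ord0.
Proof.
apply: (@eq_from_nth _ ord0) => [|i]; rewrite size_mkseq ?size_nseq// => i_n.
by rewrite nth_mkseq// nth_nseq i_n /spike modn_small ?ltn_eqF// ltnW.
Qed.

Let mkseq_spikeS n : mkseq (spike n) n.+1 = rcons (nseq n ord0) ord_max.
Proof. by rewrite mkseqS mkseq_spike /spike modn_small// eqxx. Qed.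

Let max_neq0 : (ord_max == ord0 :> letter k) = false.
Proof. by apply/eqP => /(congr1 val)/=; case: k hk => [|[]]. Qed.

Let spike_state n : foldl step false (mkseq (spike n) n.+1) = false.
Proof. by rewrite mkseq_spikeS foldl_rcons /step max_neq0. Qed.

(** Two letters [ord0] read from the even state cost 1/3 * 2/3 and lead back to it. *)
Let mass_nseq_even i v :
  mass false (nseq i.*2 ord0 ++ v) = (2 / 9) ^+ i * mass false v.
Proof.
elim: i => [|i IH]; first by rewrite mul1r.
by rewrite doubleS/= {}IH exprS /weight/=; field.
Qed.

(** This is F(n): the period of x_n has n+1 letters. *)
Let spike_log_mass n : R := log_mass n.+1 (spike n).

Let spike_log_mass_even i : spike_log_mass i.*2.+2 - spike_log_mass i.*2.+1 * 2
  + spike_log_mass i.*2 = ln 8.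
Proof.
pose a := ((2 / 9) ^+ i * weight false ord_max : R).
have a0 : 0 < a by rewrite mulr_gt0 ?weight_gt0// exprn_gt0.
have evenE j : spike_log_mass j.*2 = ln ((2 / 9) ^+ j * weight false ord_max).
  by rewrite /spike_log_mass /log_mass mkseq_spikeS -cats1 mass_nseq_even/= mulr1.
(* The extra [ord0] costs 1/3, and the last letter is then emitted from the odd state, with half the
   weight: a factor 1/6 in all. *)
have oddE : spike_log_mass i.*2.+1 = ln (a / 6).
  rewrite /spike_log_mass /log_mass mkseq_spikeS -(addn1 i.*2) nseqD -cats1 -catA.
  rewrite mass_nseq_even/= /a /weight max_neq0 eqxx/=; congr ln.
  by field; rewrite gt_eqF.
rewrite -doubleS !evenE oddE exprS -mulrA -/a.
have ln8 : ln (2 / 9) + ln 6 * 2 = ln 8 :> R.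
  by rewrite mulr_natr -lnXn// -lnM ?posrE ?exprn_gt0//; congr ln; field.
have -> : ln (2 / 9 * a) = ln (2 / 9) + ln a by rewrite lnM ?posrE.
have -> : ln (a / 6) = ln a - ln 6 by rewrite ln_div ?posrE.
by rewrite -ln8; ring.
Qed.

(** With the first term of the longer sum removed, the remaining n+1 terms pair the (j+1)-st shift
    of x_(n+1) with the j-th shift of x_n. These points agree on at least [n] letters. *)
Let spike_birkhoff phi (D theta : R) n :
  0 <= D -> 0 < theta -> theta < 1 ->
  (forall m x y, mkseq x m = mkseq y m -> `|phi x - phi y| <= D * theta ^+ m) ->
  `|birkhoff_sum phi n.+2 (spike n.+1) - birkhoff_sum phi n.+1 (spike n)
     - phi (spike n.+1)| <= n.+1%:R * (D * theta ^+ n).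
Proof.
move=> D0 t0 t1 phiD.
have telescope (a b c : R) : a + b - c - a = b - c by ring.
rewrite {1}/birkhoff_sum big_ord_recl/= telescope.
rewrite /birkhoff_sum -sumrB (le_trans (ler_norm_sum _ _ _))//.
rewrite mulr_natl -[X in _ *+ X]card_ord -sumr_const ler_sum// => j _.
apply: phiD; apply: (@eq_from_nth _ ord0) => [|i]; rewrite !size_mkseq// => i_n.
rewrite !nth_mkseq// -[left_shift _]/(iter (bump 0 j) _ _) !iter_left_shift.
rewrite /spike /bump add1n addSn; congr (if _ then _ else _).
(* Positions up to the first letter a are compared directly; later ones after removing one period
   from each point. *)
have jn := ltn_ord j; have [ji|ji] := ltnP (j + i) n.+1.
  by rewrite !modn_small.
have -> : (j + i = n.+1 + (j + i - n.+1))%N by lia.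
rewrite -addSn !modnDl !modn_small; lia.
Qed.

Lemma log_mass_not_hoelder phi : hoelder_continuous phi ->
  ~ physically_equivalent log_mass (birkhoff_sum phi).
Proof.
move=> /hoelder_prefix_decay[D [theta [D0 t0 t1 phiD]]] equiv.
have logE n : spike_log_mass n = birkhoff_sum phi n.+1 (spike n).
  apply: physically_equivalent_periodic equiv => // m.
  exact: log_mass_periodic.
(* The second difference of F at 2i combines two [spike_birkhoff] errors and phi(x_(2i+2)) -
   phi(x_(2i+1)), in total at most 4(i+1) D theta^(2i). One factor theta^i absorbs i+1, the other
   gives the decay. *)
have bound i : ln 8 <= 4 * D * (1 - theta)^-1 * theta ^+ i.
  have := spike_birkhoff i.*2 D0 t0 t1 phiD.
  have := spike_birkhoff i.*2.+1 D0 t0 t1 phiD.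
  rewrite -!logE -/(spike_log_mass _) -(spike_log_mass_even i).
  have /phiD : mkseq (spike i.*2.+1) i.*2 = mkseq (spike i.*2.+2) i.*2.
    apply: (@eq_from_nth _ ord0) => [|l]; rewrite !size_mkseq// => l_i.
    by rewrite !nth_mkseq// /spike !modn_small ?ltn_eqF//; lia.
  have := geometric_linear_bound i (_ : 0 <= theta < 1).
  rewrite t1 ltW// => /(_ isT) lin.
  have DT : 0 <= D * theta ^+ i.*2 by rewrite mulr_ge0// exprn_ge0// ltW.
  have : i.*2.+2%:R * (D * theta ^+ i.*2.+1) <= i.*2.+2%:R * (D * theta ^+ i.*2).
    by rewrite ler_wpM2l// exprSr mulrA ler_piMr// ltW.
  have : i.+1%:R * theta ^+ i * (4 * D * theta ^+ i) <=
      (1 - theta)^-1 * (4 * D * theta ^+ i).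
    by rewrite ler_wpM2r// !mulr_ge0// exprn_ge0// ltW.
  have -> : i.+1%:R * theta ^+ i * (4 * D * theta ^+ i) =
      (i.*2.+1%:R + i.*2.+2%:R + 1) * (D * theta ^+ i.*2).
    rewrite -addnn exprD -!natr1 natrD; ring.
  rewrite !ler_norml => ? ? /andP[? ?] /andP[? ?] /andP[? ?].
  lra.
have : 4 * D * (1 - theta)^-1 * theta ^+ i @[i --> \oo] -->
    4 * D * (1 - theta)^-1 * 0.
  by apply: cvgM; [exact: cvg_cst|apply: cvg_expr]; rewrite gtr0_norm.
rewrite mulr0 => /cvgr_lt /(_ (ln 8)).
case; first by rewrite ln_gt0// ltr1n.
move=> n _ /(_ n (leqnn n))/=; apply/negP; rewrite -leNgt.
exact: bound.
Qed.

End hidden_markov.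

Theorem theorem11 (R : realType) (k : nat) (hk : (2 <= k)%N) :
  (exists f : nat -> fullshift R k -> R,
    [/\ almost_additive f,
        (forall n, (1 <= n)%N -> continuous (f n)),
        (exists2 nu : probability (borel_shift R k) R,
           quasi_bernoulli nu & generated_by nu f) &
        ~ exists2 phi : fullshift R k -> R,
            hoelder_continuous phi &
            physically_equivalent f (birkhoff_sum phi)])
  /\
  (exists f : nat -> fullshift R k -> R,
    [/\ almost_additive f,
        (forall n, (1 <= n)%N -> hoelder_continuous (f n)),
        bounded_variation_seq f &
        ~ exists2 phi : fullshift R k -> R,
            hoelder_continuous phi &
            physically_equivalent f (birkhoff_sum phi)]).
Proof.
(* The n-th term depends only on the first [n] letters, which yields Hölder continuity, continuity
   and bounded variation. *)
have log_mass_hoelder n : hoelder_continuous (@log_mass R k n).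
  exact: (hoelder_prefix n (fun w => ln (mass R false w))).
split; exists (@log_mass R k); split.
- exact: log_mass_almost_additive.
- by move=> n _; exact: continuous_hoelder.
- exact: log_mass_quasi_bernoulli.
- by move=> [phi /(log_mass_not_hoelder hk)].
- exact: log_mass_almost_additive.
- by [].
- exact: (bounded_variation_prefix (fun w => ln (mass R false w))).
- by move=> [phi /(log_mass_not_hoelder hk)].
Qed.
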